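(* The category of cat-semigroups satisfying the match-up conditions (with morphisms the semigroup homomorphisms respecting $D$ and $R$) is isomorphic to the category of categories with biaction satisfying (TC4) in which the pseudoproduct $\otimes$ is associative (with morphisms the biaction functors).
   Context: Biunary semigroups. A precat-semigroup is a semigroup $S$ with two unary operations $D,R$ such that for all $x\in S$: $D(x)x=x$, $xR(x)=x$, $D(x)^2=D(x)$, $D(R(x))=R(x)$, $R(D(x))=D(x)$. A cat-semigroup is a precat-semigroup such that for all $x,y$, $R(x)=D(y)$ implies $D(xy)=D(x)$ and $R(xy)=R(y)$. The match-up conditions are the left match-up condition $R(xD(y))=D(R(xD(y))y)$ together with the right match-up condition $D(R(x)y)=R(xD(R(x)y))$, for all $x,y$. Categories. A (small) category is a set $C$ with a partial binary operation $\circ$ and unary operations $D,R$ such that for all $x,y,z\in C$: $D(x)\circ x=x$ and $x\circ R(x)=x$; $R(D(x))=D(x)$ and $D(R(x))=R(x)$; $x\circ y$ exists if and only if $R(x)=D(y)$; if $R(x)=D(y)$ then $D(x\circ y)=D(x)$ and $R(x\circ y)=R(y)$; $x\circ(y\circ z)=(x\circ y)\circ z$ whenever the two products are defined. Its set of identities is $C^0=\{D(s)\mid s\in C\}=\{R(s)\mid s\in C\}$. A category with biaction is a category $C$ equipped with everywhere-defined operations $C^0\times C\to C$, $(e,s)\mapsto e|s$ and $C\times C^0\to C$, $(s,e)\mapsto s|e$ such that: (TC1) for $e,f\in C^0$, $e|f$ is the same whether interpreted via the left or the right action; (TC2) $D(a)|a=a$ and $a|R(a)=a$ for all $a\in C$;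 (TC6) $(e|a)|f=e|(a|f)$ for all $e,f\in C^0$, $a\in C$. (TC4) For all $a,b\in C$, if $a\circ b$ exists then for all $e\in C^0$: (TC4a) $(e|a)\circ(R(e|a)|b)$ exists and $e|(a\circ b)=(e|a)\circ(R(e|a)|b)$; and (TC4b) $(a|D(b|e))\circ(b|e)$ exists and $(a\circ b)|e=(a|D(b|e))\circ(b|e)$. In a category with biaction satisfying (TC4), the left pseudoproduct $s\otimes_l t=(s|D(t))\circ(R(s|D(t))|t)$ and the right pseudoproduct $s\otimes_r t=(s|D(R(s)|t))\circ(R(s)|t)$ are everywhere defined and equal; the common operation is the pseudoproduct $\otimes$. A biaction functor is a functor $\psi:C_1\to C_2$ between categories with biaction (a map preserving $D$, $R$ and existing products $\circ$) such that $\psi(e|s)=\psi(e)|\psi(s)$ and $\psi(s|e)=\psi(s)|\psi(e)$ for all $e\in C_1^0$, $s\in C_1$. *)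

(* Defs.v *)
From Stdlib Require Import FunctionalExtensionality ProofIrrelevance.

Set Implicit Arguments.
Unset Strict Implicit.
Unset Printing Implicit Defensive.

Record category : Type := Category {
  Obj :> Type;
  Hom : Obj -> Obj -> Type;
  idm : forall A : Obj, Hom A A;
  compm : forall A B C : Obj, Hom B C -> Hom A B -> Hom A C;
  compm1 : forall (A B : Obj) (f : Hom A B), compm f (idm A) = f;
  comp1m : forall (A B : Obj) (f : Hom A B), compm (idm B) f = f;
  compmA : forall (A B C E : Obj) (h : Hom C E) (g : Hom B C) (f : Hom A B),
    compm h (compm g f) = compm (compm h g) f
}.

Record functor (C1 C2 : category) : Type := Functor {
  fobj :> C1 -> C2;
  fmap : forall A B : C1, Hom A B -> Hom (fobj A) (fobj B);
  fmap_id : forall A : C1, fmap (idm A) = idm (fobj A);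
  fmap_comp : forall (A B C : C1) (g : Hom B C) (f : Hom A B),
    fmap (compm g f) = compm (fmap g) (fmap f)
}.

Definition functor_id (C : category) : functor C C :=
  @Functor C C (fun A => A) (fun A B f => f)
    (fun A => eq_refl) (fun A B E g f => eq_refl).

Definition functor_comp (C1 C2 C3 : category)
    (G : functor C2 C3) (F : functor C1 C2) : functor C1 C3.
Proof.
refine (@Functor C1 C3 (fun A => G (F A)) (fun A B f => fmap G (fmap F f)) _ _).
- intros A; rewrite (fmap_id F); apply fmap_id.
- intros A B E g f; rewrite (fmap_comp F); apply fmap_comp.
Defined.

(** The equations are strict (Leibniz) equalities of functors: this is
    isomorphism, not equivalence, of categories. *)
Definition isomorphic_categories (C1 C2 : category) : Prop :=
  exists (F : functor C1 C2) (G : functor C2 C1),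
    functor_comp G F = functor_id C1 /\ functor_comp F G = functor_id C2.

(** Common to semigroups and small categories.  The carrier may be empty. *)
Record biunary : Type := Biunary {
  carrier :> Type;
  D : carrier -> carrier;
  R : carrier -> carrier
}.

Record biunary_semigroup : Type := BiunarySemigroup {
  bs_biunary :> biunary;
  mul : bs_biunary -> bs_biunary -> bs_biunary;
  mulA : forall x y z : bs_biunary, mul x (mul y z) = mul (mul x y) z
}.

Record is_precat_semigroup (S : biunary_semigroup) : Prop := {
  precat_Dx : forall x : S, mul (D x) x = x;
  precat_xR : forall x : S, mul x (R x) = x;
  precat_DD : forall x : S, mul (D x) (D x) = D x;
  precat_DR : forall x : S, D (R x) = R x;
  precat_RD : forall x : S, R (D x) = D x
}.

Record is_cat_semigroup (S : biunary_semigroup) : Prop := {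
  cat_precat : is_precat_semigroup S;
  cat_mul : forall x y : S,
    R x = D y -> D (mul x y) = D x /\ R (mul x y) = R y
}.

Definition left_match_up (S : biunary_semigroup) : Prop :=
  forall x y : S, R (mul x (D y)) = D (mul (R (mul x (D y))) y).

Definition right_match_up (S : biunary_semigroup) : Prop :=
  forall x y : S, D (mul (R x) y) = R (mul x (D (mul (R x) y))).

Definition match_up (S : biunary_semigroup) : Prop :=
  left_match_up S /\ right_match_up S.

Record match_up_cat_semigroup : Type := MatchUpCatSemigroup {
  mu_semigroup :> biunary_semigroup;
  mu_cat : is_cat_semigroup mu_semigroup;
  mu_match_up : match_up mu_semigroup
}.

Record semigroup_hom (S T : biunary_semigroup) : Type := SemigroupHom {
  sh_fun :> S -> T;
  sh_mul : forall x y : S, sh_fun (mul x y) = mul (sh_fun x) (sh_fun y);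
  sh_D : forall x : S, sh_fun (D x) = D (sh_fun x);
  sh_R : forall x : S, sh_fun (R x) = R (sh_fun x)
}.

Lemma semigroup_hom_ext (S T : biunary_semigroup) (f g : semigroup_hom S T) :
  (forall x, f x = g x) -> f = g.
Proof.
destruct f as [f f1 f2 f3], g as [g g1 g2 g3]; simpl; intros E.
assert (f = g) by (apply functional_extensionality; exact E); subst g.
f_equal; apply proof_irrelevance.
Qed.

Definition semigroup_hom_id (S : biunary_semigroup) : semigroup_hom S S :=
  @SemigroupHom S S (fun x => x) (fun x y => eq_refl)
    (fun x => eq_refl) (fun x => eq_refl).

Definition semigroup_hom_comp (S T U : biunary_semigroup)
    (g : semigroup_hom T U) (f : semigroup_hom S T) : semigroup_hom S U.
Proof.
refine (@SemigroupHom S U (fun x => g (f x)) _ _ _); intros.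
- rewrite sh_mul; apply sh_mul.
- rewrite sh_D; apply sh_D.
- rewrite sh_R; apply sh_R.
Defined.

Definition cat_of_match_up_cat_semigroups : category.
Proof.
refine (@Category match_up_cat_semigroup
  (fun S T => semigroup_hom S T)
  (fun S => semigroup_hom_id S)
  (fun S T U g f => semigroup_hom_comp g f) _ _ _);
  intros; apply semigroup_hom_ext; reflexivity.
Defined.

(** [comp x y = Some z] means that [x ∘ y] exists and equals [z];
    composition is written in diagrammatic order. *)
Record small_category : Type := SmallCategory {
  sc_biunary :> biunary;
  comp : sc_biunary -> sc_biunary -> option sc_biunary;
  comp_Dx : forall x : sc_biunary, comp (D x) x = Some x;
  comp_xR : forall x : sc_biunary, comp x (R x) = Some x;
  sc_RD : forall x : sc_biunary, R (D x) = D x;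
  sc_DR : forall x : sc_biunary, D (R x) = R x;
  comp_exists : forall x y : sc_biunary,
    (exists z, comp x y = Some z) <-> R x = D y;
  comp_DR : forall x y z : sc_biunary,
    R x = D y -> comp x y = Some z -> D z = D x /\ R z = R y;
  compA : forall x y z xy yz l r : sc_biunary,
    comp y z = Some yz -> comp x yz = Some l ->
    comp x y = Some xy -> comp xy z = Some r -> l = r
}.

Record identity (C : small_category) : Type := Identity {
  ident_val :> C;
  identP : exists s : C, ident_val = D s
}.

Definition identD (C : small_category) (s : C) : identity C :=
  @Identity C (D s) (ex_intro _ s eq_refl).

Definition identR (C : small_category) (s : C) : identity C :=
  @Identity C (R s) (ex_intro _ (R s) (eq_sym (sc_DR s))).

Record small_functor (C1 C2 : small_category) : Type := SmallFunctor {
  sf_fun :> C1 -> C2;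
  sf_D : forall s : C1, sf_fun (D s) = D (sf_fun s);
  sf_R : forall s : C1, sf_fun (R s) = R (sf_fun s);
  sf_comp : forall s t u : C1,
    comp s t = Some u -> comp (sf_fun s) (sf_fun t) = Some (sf_fun u)
}.

Definition sf_ident (C1 C2 : small_category) (psi : small_functor C1 C2)
    (e : identity C1) : identity C2.
Proof.
refine (@Identity C2 (psi e) _).
destruct (identP e) as [s E]; exists (psi s); rewrite E; apply sf_D.
Defined.

(** [lact e s] is [e|s] and [ract s e] is [s|e]. *)
Record biaction_category : Type := BiactionCategory {
  bc_category :> small_category;
  lact : identity bc_category -> bc_category -> bc_category;
  ract : bc_category -> identity bc_category -> bc_category;
  TC1 : forall e f : identity bc_category, lact e f = ract e f;
  TC2_l : forall a : bc_category, lact (identD a) a = a;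
  TC2_r : forall a : bc_category, ract a (identR a) = a;
  TC6 : forall (e f : identity bc_category) (a : bc_category),
    ract (lact e a) f = lact e (ract a f)
}.

Definition TC4a (C : biaction_category) : Prop :=
  forall a b ab : C, comp a b = Some ab -> forall e : identity C,
    comp (lact e a) (lact (identR (lact e a)) b) = Some (lact e ab).

Definition TC4b (C : biaction_category) : Prop :=
  forall a b ab : C, comp a b = Some ab -> forall e : identity C,
    comp (ract a (identD (ract b e))) (ract b e) = Some (ract ab e).

Definition TC4 (C : biaction_category) : Prop := TC4a C /\ TC4b C.

Definition pseudoproduct_l (C : biaction_category) (s t : C) : option C :=
  comp (ract s (identD t)) (lact (identR (ract s (identD t))) t).

Definition pseudoproduct_r (C : biaction_category) (s t : C) : option C :=
  comp (ract s (identD (lact (identR s) t))) (lact (identR s) t).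

Lemma identity_eq (C : small_category) (e f : identity C) :
  ident_val e = ident_val f -> e = f.
Proof.
destruct e as [e he], f as [f hf]; simpl; intros E; subst f.
f_equal; apply proof_irrelevance.
Qed.

Lemma pseudoproduct_total (C : biaction_category) : TC4 C ->
  forall s t : C, exists u : C,
    pseudoproduct_l s t = Some u /\ pseudoproduct_r s t = Some u.
Proof.
intros [ha hb] s t.
pose (Rs := identR s); pose (Dt := identD t).
assert (Eb : comp (ract s (identD (ract (R s) Dt))) (ract (R s) Dt)
             = Some (ract s Dt)) by (apply hb, comp_xR).
assert (Ea : comp (lact Rs (D t)) (lact (identR (lact Rs (D t))) t)
             = Some (lact Rs t)) by (apply ha, comp_Dx).
assert (E1 : lact Rs (D t) = ract (R s) Dt) by exact (TC1 Rs Dt).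
rewrite E1 in Ea.
assert (hRb : R (ract s (identD (ract (R s) Dt))) = D (ract (R s) Dt))
  by (apply comp_exists; eexists; exact Eb).
assert (hRa : R (ract (R s) Dt) = D (lact (identR (ract (R s) Dt)) t))
  by (apply comp_exists; eexists; exact Ea).
destruct (comp_DR hRb Eb) as [_ hR].
destruct (comp_DR hRa Ea) as [hD _].
assert (ER : identR (ract s Dt) = identR (ract (R s) Dt))
  by (apply identity_eq; exact hR).
assert (ED : identD (lact Rs t) = identD (ract (R s) Dt))
  by (apply identity_eq; exact hD).
unfold pseudoproduct_l, pseudoproduct_r; fold Rs; fold Dt.
rewrite ER, ED.
assert (hl : exists l, comp (ract s Dt) (lact (identR (ract (R s) Dt)) t)
                       = Some l)
  by (apply comp_exists; rewrite hR; exact hRa).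
assert (hr : exists r, comp (ract s (identD (ract (R s) Dt))) (lact Rs t)
                       = Some r)
  by (apply comp_exists; rewrite hD; exact hRb).
destruct hl as [l hl], hr as [r hr].
exists l; split; [exact hl|].
rewrite hr; f_equal; exact (compA Ea hr Eb hl).
Qed.

Lemma pseudoproduct_defined (C : biaction_category) (h : TC4 C) (s t : C) :
  pseudoproduct_l s t <> None.
Proof. destruct (pseudoproduct_total h s t) as [u [E _]]; congruence. Qed.
Arguments pseudoproduct_defined [C] h s t _.

Definition value (A : Type) (o : option A) : o <> None -> A :=
  match o return o <> None -> A with
  | Some a => fun _ => a
  | None => fun h => False_rect A (h eq_refl)
  end.

Lemma valueP (A : Type) (o : option A) (h : o <> None) : o = Some (value h).
Proof. destruct o as [a|]; [reflexivity|contradiction]. Qed.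

Definition pseudoproduct (C : biaction_category) (h : TC4 C) (s t : C) : C :=
  value (pseudoproduct_defined h s t).

Lemma pseudoproduct_lE (C : biaction_category) (h : TC4 C) (s t : C) :
  pseudoproduct_l s t = Some (pseudoproduct h s t).
Proof. apply valueP. Qed.

Lemma pseudoproduct_rE (C : biaction_category) (h : TC4 C) (s t : C) :
  pseudoproduct_r s t = Some (pseudoproduct h s t).
Proof.
rewrite <- pseudoproduct_lE.
destruct (pseudoproduct_total h s t) as [u [E1 E2]]; congruence.
Qed.

Record assoc_biaction_category : Type := AssocBiactionCategory {
  ab_biaction :> biaction_category;
  ab_TC4 : TC4 ab_biaction;
  ab_assoc : forall s t u : ab_biaction,
    pseudoproduct ab_TC4 s (pseudoproduct ab_TC4 t u)
    = pseudoproduct ab_TC4 (pseudoproduct ab_TC4 s t) u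
}.

Record biaction_functor (C1 C2 : biaction_category) : Type := BiactionFunctor {
  bf_functor :> small_functor C1 C2;
  bf_lact : forall (e : identity C1) (s : C1),
    bf_functor (lact e s) = lact (sf_ident bf_functor e) (bf_functor s);
  bf_ract : forall (s : C1) (e : identity C1),
    bf_functor (ract s e) = ract (bf_functor s) (sf_ident bf_functor e)
}.

Lemma biaction_functor_ext (C1 C2 : biaction_category)
    (f g : biaction_functor C1 C2) : (forall x, f x = g x) -> f = g.
Proof.
destruct f as [[f f1 f2 f3] f4 f5], g as [[g g1 g2 g3] g4 g5].
simpl; intros E.
assert (f = g) by (apply functional_extensionality; exact E); subst g.
assert (f1 = g1) by apply proof_irrelevance; subst g1.
assert (f2 = g2) by apply proof_irrelevance; subst g2.
assert (f3 = g3) by apply proof_irrelevance; subst g3.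
f_equal; apply proof_irrelevance.
Qed.

Definition small_functor_id (C : small_category) : small_functor C C :=
  @SmallFunctor C C (fun s => s) (fun s => eq_refl) (fun s => eq_refl)
    (fun s t u h => h).

Definition small_functor_comp (C1 C2 C3 : small_category)
    (g : small_functor C2 C3) (f : small_functor C1 C2) : small_functor C1 C3.
Proof.
refine (@SmallFunctor C1 C3 (fun s => g (f s)) _ _ _); intros.
- rewrite sf_D; apply sf_D.
- rewrite sf_R; apply sf_R.
- apply sf_comp, sf_comp; assumption.
Defined.

Definition biaction_functor_id (C : biaction_category) : biaction_functor C C.
Proof.
refine (@BiactionFunctor C C (small_functor_id C) _ _); intros; simpl;
  f_equal; apply identity_eq; reflexivity.
Defined.

Definition biaction_functor_comp (C1 C2 C3 : biaction_category)
    (g : biaction_functor C2 C3) (f : biaction_functor C1 C2) :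
  biaction_functor C1 C3.
Proof.
refine (@BiactionFunctor C1 C3 (small_functor_comp g f) _ _); intros; simpl.
- rewrite bf_lact, bf_lact; f_equal; apply identity_eq; reflexivity.
- rewrite bf_ract, bf_ract; f_equal; apply identity_eq; reflexivity.
Defined.

Definition cat_of_assoc_biaction_categories : category.
Proof.
refine (@Category assoc_biaction_category
  (fun C1 C2 => biaction_functor C1 C2)
  (fun C => biaction_functor_id C)
  (fun C1 C2 C3 g f => biaction_functor_comp g f) _ _ _);
  intros; apply biaction_functor_ext; reflexivity.
Defined.

(* Main.v *)
From Stdlib Require Import FunctionalExtensionality ProofIrrelevance.
From Stdlib Require Import ClassicalEpsilon.
Require Import Defs.

Set Implicit Arguments.
Unset Strict Implicit.
Unset Printing Implicit Defensive.

(** Both kinds of object live on the same biunary set, and each product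
    determines the other.  A cat-semigroup [S] becomes a category by keeping
    only the products [x y] with [R x = D y]; its biaction is multiplication by
    elements [D s].  The two match-up conditions say precisely that the
    composites in (TC4a) and (TC4b) exist, and associativity gives their
    values.  Conversely, a category with biaction becomes a semigroup under its
    pseudoproduct, and the existence of the left and right pseudoproducts is
    exactly the left and right match-up condition.

    The passages are mutually inverse for two reasons.  In [S], inserting
    [D t] and [R (s D t)] between [s] and [t] does not change [s t], so the
    pseudoproduct of the derived category is the multiplication
    ([pseudoproduct_semigroup]).  In a category with biaction, the
    pseudoproduct restricts to composition on composable pairs
    ([pseudoproduct_composable]) and to the biaction when one factor is an
    identity ([pseudoproduct_identity_l], [pseudoproduct_identity_r]).  On
    morphisms both functors keep the underlying map.

    Since the isomorphism is strict, the round trips have to be equal to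
    identity functors, although a round trip on an object is equal to that
    object only after function extensionality.  [functor_eq] reduces such an
    equality of functors to a naturality square whose sides are the morphisms
    [eqhom p] induced by equalities [p] of objects; these morphisms act as the
    identity because the underlying biunary set is literally unchanged, so that
    [p] induces on it an equality of a type with itself, which is trivial by
    uniqueness of identity proofs. *)

(** * Strict equality of functors *)

Definition eqhom (C : category) (A B : C) (p : A = B) : Hom A B :=
  match p in _ = B return Hom A B with eq_refl => idm A end.

(** A natural isomorphism all of whose components come from equalities of
    objects is an equality: once the object maps are identified, each component
    is an identity morphism and the square reads [fmap F f = fmap G f]. *)
Lemma functor_eq (C1 C2 : category) (F G : functor C1 C2)
    (p : forall A, F A = G A) :
  (forall (A B : C1) (f : Hom A B),
     compm (eqhom (p B)) (fmap F f) = compm (fmap G f) (eqhom (p A))) ->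
  F = G.
Proof.
destruct F as [F f f1 f2], G as [G g g1 g2]; simpl in *; intros N.
assert (F = G) by (apply functional_extensionality; exact p); subst G.
assert (f = g).
{ apply functional_extensionality_dep; intros A.
  apply functional_extensionality_dep; intros B.
  apply functional_extensionality; intros h.
  specialize (N A B h).
  rewrite (proof_irrelevance _ (p A) eq_refl) in N.
  rewrite (proof_irrelevance _ (p B) eq_refl) in N.
  simpl in N; rewrite comp1m, compm1 in N; exact N. }
subst g; f_equal; apply proof_irrelevance.
Qed.

Definition cast (A B : Type) (p : A = B) (x : A) : B :=
  match p in _ = B return B with eq_refl => x end.

Lemma cast_id (A : Type) (p : A = A) (x : A) : cast p x = x.
Proof. rewrite (proof_irrelevance _ p eq_refl); reflexivity. Qed.

Lemma eqhom_semigroup (S T : cat_of_match_up_cat_semigroups) (p : S = T)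
    (x : S) :
  sh_fun (eqhom p) x
  = cast (f_equal (fun U : match_up_cat_semigroup => carrier U) p) x.
Proof. destruct p; reflexivity. Qed.

Lemma eqhom_biaction (C1 C2 : cat_of_assoc_biaction_categories) (p : C1 = C2)
    (x : C1) :
  sf_fun (eqhom p) x
  = cast (f_equal (fun C : assoc_biaction_category => carrier C) p) x.
Proof. destruct p; reflexivity. Qed.

Lemma match_up_cat_semigroup_eq (X : biunary) (m m' : X -> X -> X) a a' c c'
    u u' :
  (forall x y, m x y = m' x y) ->
  @MatchUpCatSemigroup (@BiunarySemigroup X m a) c u
  = @MatchUpCatSemigroup (@BiunarySemigroup X m' a') c' u'.
Proof.
intros E.
assert (m = m').
{ apply functional_extensionality; intros x.
  apply functional_extensionality; intros y; apply E. }
subst m'; assert (a' = a) by apply proof_irrelevance; subst a'.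
f_equal; apply proof_irrelevance.
Qed.

(** The actions are compared on identities with equal values because the types
    [identity _] of the two categories differ until the compositions have been
    identified. *)
Lemma assoc_biaction_category_eq (X : biunary)
    (c c' : X -> X -> option X) h1 h2 h3 h4 h5 h6 h7 h1' h2' h3' h4' h5' h6' h7'
    (C := @SmallCategory X c h1 h2 h3 h4 h5 h6 h7)
    (C' := @SmallCategory X c' h1' h2' h3' h4' h5' h6' h7')
    (l : identity C -> X -> X) (l' : identity C' -> X -> X)
    (r : X -> identity C -> X) (r' : X -> identity C' -> X)
    t1 t2 t3 t4 t1' t2' t3' t4' u u' v v' :
  (forall x y, c x y = c' x y) ->
  (forall (e : identity C) (e' : identity C') x,
     ident_val e = ident_val e' :> X -> l e x = l' e' x) ->
  (forall (e : identity C) (e' : identity C') x,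
     ident_val e = ident_val e' :> X -> r x e = r' x e') ->
  @AssocBiactionCategory (@BiactionCategory C l r t1 t2 t3 t4) u v
  = @AssocBiactionCategory (@BiactionCategory C' l' r' t1' t2' t3' t4') u' v'.
Proof.
intros Ec El Er.
assert (c = c').
{ apply functional_extensionality; intros x.
  apply functional_extensionality; intros y; apply Ec. }
subst c'.
assert (h1' = h1) by apply proof_irrelevance; subst h1'.
assert (h2' = h2) by apply proof_irrelevance; subst h2'.
assert (h3' = h3) by apply proof_irrelevance; subst h3'.
assert (h4' = h4) by apply proof_irrelevance; subst h4'.
assert (h5' = h5) by apply proof_irrelevance; subst h5'.
assert (h6' = h6) by apply proof_irrelevance; subst h6'.
assert (h7' = h7) by apply proof_irrelevance; subst h7'.
assert (l = l').
{ apply functional_extensionality; intros e.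
  apply functional_extensionality; intros x; apply El; reflexivity. }
assert (r = r').
{ apply functional_extensionality; intros x.
  apply functional_extensionality; intros e; apply Er; reflexivity. }
subst l' r'.
assert (t1' = t1) by apply proof_irrelevance; subst t1'.
assert (t2' = t2) by apply proof_irrelevance; subst t2'.
assert (t3' = t3) by apply proof_irrelevance; subst t3'.
assert (t4' = t4) by apply proof_irrelevance; subst t4'.
assert (u' = u) by apply proof_irrelevance; subst u'.
f_equal; apply proof_irrelevance.
Qed.

(** * From cat-semigroups to categories with biaction *)

Section SemigroupToCategory.

Variable S : match_up_cat_semigroup.

(** Composability is an equation in an arbitrary type, so restricting the
    multiplication to composable pairs uses classical decidability. *)
Definition restricted_mul (x y : S) : option S :=
  if excluded_middle_informative (R x = D y) then Some (mul x y) else None.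

Lemma restricted_mul_Some (x y z : S) :
  restricted_mul x y = Some z <-> R x = D y /\ mul x y = z.
Proof.
unfold restricted_mul; destruct excluded_middle_informative as [E|E].
- split; [intros H; injection H; auto | intros [_ H]; congruence].
- split; [discriminate | tauto].
Qed.

Let precat : is_precat_semigroup S := cat_precat (mu_cat S).

Definition category_of_semigroup : small_category.
Proof.
refine (@SmallCategory S restricted_mul _ _ _ _ _ _ _).
- intros x; apply restricted_mul_Some; split;
    [apply (precat_RD precat) | apply (precat_Dx precat)].
- intros x; apply restricted_mul_Some; split;
    [symmetry; apply (precat_DR precat) | apply (precat_xR precat)].
- apply (precat_RD precat).
- apply (precat_DR precat).
- intros x y; split.
  + intros [z H]; apply (restricted_mul_Some x y z), H.
  + intros E; exists (mul x y); apply restricted_mul_Some; auto.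
- intros x y z E H; apply restricted_mul_Some in H; destruct H as [_ <-].
  apply (cat_mul (mu_cat S) E).
- intros x y z xy yz l r H1 H2 H3 H4.
  apply restricted_mul_Some in H1, H2, H3, H4.
  destruct H1 as [_ <-], H2 as [_ <-], H3 as [_ <-], H4 as [_ <-].
  apply mulA.
Defined.

Definition biaction_category_of_semigroup : biaction_category.
Proof.
refine (@BiactionCategory category_of_semigroup
  (fun e s => mul (ident_val e : S) s) (fun s e => mul s (ident_val e : S))
  _ _ _ _).
- reflexivity.
- apply (precat_Dx precat).
- apply (precat_xR precat).
- intros e f a; symmetry; apply mulA.
Defined.

(** The left match-up condition at [x = e a], [y = b] gives existence of the
    composite in (TC4a), since [e a D(b) = e a R(a) = e a]; dually for
    (TC4b). *)
Lemma semigroup_TC4 : TC4 biaction_category_of_semigroup.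
Proof.
split; intros a b ab H e; apply restricted_mul_Some in H;
  destruct H as [E <-]; apply restricted_mul_Some; simpl in *.
- assert (H : mul (mul (ident_val e : S) a) (D b) = mul (ident_val e : S) a)
    by (rewrite <- E, <- mulA; f_equal; apply (precat_xR precat)).
  split.
  + pose proof (proj1 (mu_match_up S) (mul (ident_val e : S) a) b) as M.
    rewrite H in M; exact M.
  + rewrite mulA, (precat_xR precat), mulA; reflexivity.
- assert (H : mul (R a) (mul b (ident_val e : S)) = mul b (ident_val e : S))
    by (rewrite E, mulA; f_equal; apply (precat_Dx precat)).
  split.
  + pose proof (proj2 (mu_match_up S) a (mul b (ident_val e : S))) as M.
    rewrite H in M; symmetry; exact M.
  + rewrite <- mulA, (precat_Dx precat), mulA; reflexivity.
Qed.

Lemma pseudoproduct_semigroup (h : TC4 biaction_category_of_semigroup)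
    (s t : S) :
  pseudoproduct h (s : biaction_category_of_semigroup) t = mul s t.
Proof.
pose proof (pseudoproduct_lE h (s : biaction_category_of_semigroup) t) as H.
apply restricted_mul_Some in H; destruct H as [_ <-]; simpl.
rewrite mulA, (precat_xR precat), <- mulA, (precat_Dx precat); reflexivity.
Qed.

Definition assoc_biaction_category_of_semigroup : assoc_biaction_category.
Proof.
refine (@AssocBiactionCategory biaction_category_of_semigroup semigroup_TC4 _).
intros s t u; rewrite !pseudoproduct_semigroup; apply mulA.
Defined.

End SemigroupToCategory.

Definition biaction_functor_of_hom (S T : match_up_cat_semigroup)
    (f : semigroup_hom S T) :
  biaction_functor (assoc_biaction_category_of_semigroup S)
                   (assoc_biaction_category_of_semigroup T).
Proof.
unshelve refine (@BiactionFunctor (biaction_category_of_semigroup S)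
  (biaction_category_of_semigroup T)
  (@SmallFunctor (category_of_semigroup S) (category_of_semigroup T) f
     _ _ _) _ _).
- apply sh_D.
- apply sh_R.
- intros s t u H; apply restricted_mul_Some in H; destruct H as [E <-].
  apply restricted_mul_Some; split.
  + rewrite <- sh_R, <- sh_D, E; reflexivity.
  + symmetry; apply sh_mul.
- intros e s; apply sh_mul.
- intros s e; apply sh_mul.
Defined.

Definition functor_to_categories :
  functor cat_of_match_up_cat_semigroups cat_of_assoc_biaction_categories.
Proof.
refine (@Functor cat_of_match_up_cat_semigroups
  cat_of_assoc_biaction_categories assoc_biaction_category_of_semigroup
  biaction_functor_of_hom _ _);
  intros; apply biaction_functor_ext; reflexivity.
Defined.

(** * From categories with biaction to cat-semigroups *)

Lemma D_identity (C : small_category) (e : identity C) : D e = e.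
Proof.
destruct e as [e [s ->]]; simpl.
rewrite <- (sc_RD s), sc_DR; reflexivity.
Qed.

Lemma R_identity (C : small_category) (e : identity C) : R e = e.
Proof. rewrite <- (D_identity e), sc_RD; reflexivity. Qed.

Section Pseudoproduct.

Variables (C : biaction_category) (h : TC4 C).

Lemma pseudoproduct_composable (s t : C) :
  R s = D t -> comp s t = Some (pseudoproduct h s t).
Proof.
intros E; rewrite <- pseudoproduct_lE; unfold pseudoproduct_l.
assert (E1 : ract s (identD t) = s).
{ rewrite <- (TC2_r s) at 2; f_equal; apply identity_eq; symmetry; exact E. }
rewrite E1; f_equal.
rewrite <- (TC2_l t) at 1; f_equal; apply identity_eq; symmetry; exact E.
Qed.

(** The left pseudoproduct of [e] and [s] is the composite that (TC4a) assigns
    to [e|(D(s) s)], because [e|D(s)] does not depend on the side of the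
    action. *)
Lemma pseudoproduct_identity_l (e : identity C) (s : C) :
  pseudoproduct h e s = lact e s.
Proof.
pose proof (pseudoproduct_lE h e s) as H; unfold pseudoproduct_l in H.
pose proof (proj1 h _ _ _ (comp_Dx s) e) as H'.
rewrite (TC1 e (identD s) : lact e (D s) = _) in H'; congruence.
Qed.

Lemma pseudoproduct_identity_r (s : C) (e : identity C) :
  pseudoproduct h s e = ract s e.
Proof.
pose proof (pseudoproduct_rE h s e) as H; unfold pseudoproduct_r in H.
pose proof (proj2 h _ _ _ (comp_xR s) e) as H'.
rewrite <- (TC1 (identR s) e : _ = ract (R s) e) in H'; congruence.
Qed.

Lemma pseudoproduct_Dl (s t : C) : pseudoproduct h (D s) t = lact (identD s) t.
Proof. exact (pseudoproduct_identity_l (identD s) t). Qed.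

Lemma pseudoproduct_Rl (s t : C) : pseudoproduct h (R s) t = lact (identR s) t.
Proof. exact (pseudoproduct_identity_l (identR s) t). Qed.

Lemma pseudoproduct_Dr (s t : C) : pseudoproduct h s (D t) = ract s (identD t).
Proof. exact (pseudoproduct_identity_r s (identD t)). Qed.

Lemma pseudoproduct_Rr (s t : C) : pseudoproduct h s (R t) = ract s (identR t).
Proof. exact (pseudoproduct_identity_r s (identR t)). Qed.

End Pseudoproduct.

Section CategoryToSemigroup.

Variable C : assoc_biaction_category.

Definition semigroup_of_category : biunary_semigroup :=
  @BiunarySemigroup C (pseudoproduct (ab_TC4 C)) (@ab_assoc C).

Lemma semigroup_of_category_cat : is_cat_semigroup semigroup_of_category.
Proof.
split; [split|]; simpl.
- intros x; rewrite pseudoproduct_Dl; apply TC2_l.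
- intros x; rewrite pseudoproduct_Rr; apply TC2_r.
- intros x; rewrite pseudoproduct_Dl.
  rewrite <- (TC2_l (D x)) at 2; f_equal; apply identity_eq.
  symmetry; exact (D_identity (identD x)).
- apply sc_DR.
- apply sc_RD.
- intros x y E; exact (comp_DR E (pseudoproduct_composable (ab_TC4 C) E)).
Qed.

Lemma semigroup_of_category_match_up : match_up semigroup_of_category.
Proof.
split; intros x y; simpl.
- rewrite pseudoproduct_Dr, pseudoproduct_Rl.
  apply comp_exists; eexists; apply (pseudoproduct_lE (ab_TC4 C)).
- rewrite pseudoproduct_Rl, pseudoproduct_Dr; symmetry.
  apply comp_exists; eexists; apply (pseudoproduct_rE (ab_TC4 C)).
Qed.

Definition match_up_cat_semigroup_of_category : match_up_cat_semigroup :=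
  MatchUpCatSemigroup semigroup_of_category_cat semigroup_of_category_match_up.

End CategoryToSemigroup.

Lemma biaction_functor_pseudoproduct (C1 C2 : biaction_category)
    (h1 : TC4 C1) (h2 : TC4 C2) (f : biaction_functor C1 C2) (s t : C1) :
  f (pseudoproduct h1 s t) = pseudoproduct h2 (f s) (f t).
Proof.
pose proof (sf_comp f (pseudoproduct_lE h1 s t)) as H.
rewrite bf_lact, bf_ract in H.
pose proof (pseudoproduct_lE h2 (f s) (f t)) as H'; unfold pseudoproduct_l in H'.
assert (ED : sf_ident f (identD t) = identD (f t))
  by (apply identity_eq, sf_D).
assert (ER : sf_ident f (identR (ract s (identD t)))
             = identR (ract (f s) (identD (f t)))).
{ apply identity_eq; simpl; rewrite sf_R, bf_ract, ED; reflexivity. }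
rewrite ED, ER in H; congruence.
Qed.

Definition hom_of_biaction_functor (C1 C2 : assoc_biaction_category)
    (f : biaction_functor C1 C2) :
  semigroup_hom (match_up_cat_semigroup_of_category C1)
                (match_up_cat_semigroup_of_category C2) :=
  @SemigroupHom (semigroup_of_category C1) (semigroup_of_category C2) f
    (biaction_functor_pseudoproduct (ab_TC4 C1) (ab_TC4 C2) f)
    (sf_D f) (sf_R f).

Definition functor_to_semigroups :
  functor cat_of_assoc_biaction_categories cat_of_match_up_cat_semigroups.
Proof.
refine (@Functor cat_of_assoc_biaction_categories
  cat_of_match_up_cat_semigroups match_up_cat_semigroup_of_category
  hom_of_biaction_functor _ _);
  intros; apply semigroup_hom_ext; reflexivity.
Defined.

(** * The round trips *)

Lemma semigroup_round_trip (S : match_up_cat_semigroup) :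
  match_up_cat_semigroup_of_category (assoc_biaction_category_of_semigroup S)
  = S.
Proof.
destruct S as [[X m a] c u].
apply match_up_cat_semigroup_eq; intros x y.
exact (pseudoproduct_semigroup (S := MatchUpCatSemigroup c u) _ x y).
Qed.

Lemma category_round_trip (C : assoc_biaction_category) :
  assoc_biaction_category_of_semigroup (match_up_cat_semigroup_of_category C)
  = C.
Proof.
destruct C as [[[X c h1 h2 h3 h4 h5 h6 h7] l r t1 t2 t3 t4] u v].
set (B := BiactionCategory t1 t2 t3 t4) in *.
apply assoc_biaction_category_eq.
- intros x y; change (restricted_mul (S := match_up_cat_semigroup_of_category
    (AssocBiactionCategory v)) x y = comp (x : B) y).
  unfold restricted_mul; destruct excluded_middle_informative as [E|E].
  + symmetry; exact (pseudoproduct_composable (C := B) u E).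
  + destruct (comp (x : B) y) as [z|] eqn:Ez; [|reflexivity].
    destruct E; apply (comp_exists (x : B) y); exists z; exact Ez.
- intros e e' x E.
  etransitivity; [|exact (pseudoproduct_identity_l (C := B) u e' x)].
  exact (f_equal (fun y : B => pseudoproduct u y x) E).
- intros e e' x E.
  etransitivity; [|exact (pseudoproduct_identity_r (C := B) u x e')].
  exact (f_equal (fun y : B => pseudoproduct u x y) E).
Qed.

Theorem theorem4p16 :
  isomorphic_categories
    cat_of_match_up_cat_semigroups cat_of_assoc_biaction_categories.
Proof.
exists functor_to_categories, functor_to_semigroups; split.
- apply (functor_eq (F := functor_comp functor_to_semigroups
    functor_to_categories) (G := functor_id _) (p := semigroup_round_trip)).
  intros S T f; apply semigroup_hom_ext; intros x.
  transitivity (f x).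
  + exact (eq_trans (eqhom_semigroup (semigroup_round_trip T) (f x)) (cast_id _ _)).
  + symmetry; apply (f_equal f).
    exact (eq_trans (eqhom_semigroup (semigroup_round_trip S) x) (cast_id _ _)).
- apply (functor_eq (F := functor_comp functor_to_categories
    functor_to_semigroups) (G := functor_id _) (p := category_round_trip)).
  intros C1 C2 f; apply biaction_functor_ext; intros x.
  transitivity (f x).
  + exact (eq_trans (eqhom_biaction (category_round_trip C2) (f x)) (cast_id _ _)).
  + symmetry; apply (f_equal f).
    exact (eq_trans (eqhom_biaction (category_round_trip C1) x) (cast_id _ _)).
Qed.
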